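(* Let $m,n,r$ be positive integers, let $\mathcal{A},\mathcal{B}\in\mathbb{R}^{m\times n\times r}$, let $n'=\min\{m,n\}$, and let $$\alpha_1\ge\cdots\ge\alpha_{n'}\ge 0,\qquad \beta_1\ge\cdots\ge\beta_{n'}\ge 0$$ be the (tensor) singular values of $\mathcal{A}$ and $\mathcal{B}$ respectively. Then $$\left[\sum_{i=1}^{n'}(\alpha_i-\beta_i)^2\right]^{1/2}\le\|\mathcal{B}-\mathcal{A}\|_F,$$ $$|\alpha_j-\beta_j|\le\sigma_{\max}(\mathcal{B}-\mathcal{A}),\qquad j=1,2,\dots,n'.$$
   Context: For a third-order tensor $\mathcal{A}\in\mathbb{R}^{m\times n\times r}$, let $A_k=\mathcal{A}(:,:,k)\in\mathbb{R}^{m\times n}$, $k=1,\dots,r$, be its frontal slices. Let $\hat{\mathcal{A}}\in\mathbb{C}^{m\times n\times r}$ be the tensor obtained by applying the discrete Fourier transform along the third mode, i.e. its frontal slices are $\hat A_k=\sum_{j=1}^{r}\omega^{(k-1)(j-1)}A_j$ with $\omega=e^{-2\pi \mathtt{i}/r}$. Tensor singular values: $\mathcal{A}$ has a T-SVD $\mathcal{A}=\mathcal{U}*\mathcal{S}*\mathcal{V}^{\mathrm T}$ (with respect to the T-product $*$, with $\mathcal{U},\mathcal{V}$ orthogonal tensors and $\mathcal{S}$ having diagonal frontal slices) in which the diagonal of the $k$-th Fourier-transformed frontal slice $\hat{S}_k$ of $\mathcal{S}$ consists of the singular values of the matrix $\hat A_k$ in decreasing order. The singular values of $\mathcal{A}$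 are the diagonal entries of the first frontal slice $\mathcal{S}(:,:,1)$. Equivalently, if $\sigma_1(\hat A_k)\ge\cdots\ge\sigma_{\min\{m,n\}}(\hat A_k)\ge 0$ are the ordinary singular values of $\hat A_k$, the $i$-th singular value of $\mathcal{A}$ is $$\sigma_i(\mathcal{A})=\frac1r\sum_{k=1}^{r}\sigma_i(\hat A_k),\qquad i=1,\dots,\min\{m,n\}.$$ $\sigma_{\max}(\mathcal{A})=\sigma_1(\mathcal{A})$ denotes the largest singular value of $\mathcal{A}$. The Frobenius norm is $\|\mathcal{A}\|_F=\sqrt{\sum_{i=1}^{m}\sum_{j=1}^{n}\sum_{k=1}^{r}a_{ijk}^2}$ for $\mathcal{A}=(a_{ijk})$. *)

(* Defs.v *)
From HB Require Import structures.
From mathcomp Require Import all_boot all_order all_algebra spectral complex.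
From mathcomp Require Import reals trigo.
From mathcomp Require Import ring lra.

Set Implicit Arguments.
Unset Strict Implicit.
Unset Printing Implicit Defensive.

Import Order.TTheory GRing.Theory Num.Theory.
Local Open Scope ring_scope.
Local Open Scope complex_scope.
Local Open Scope sesquilinear_scope.

(* An m x n x r tensor is the family of its r frontal slices, which are
   indexed from 0. *)
Notation "''T[' R ]_ ( m , n , r )" := {ffun 'I_r -> 'M[R]_(m, n)}
  (at level 0, R at level 2, m, n, r at level 99) : type_scope.

(* [sv M i] is the (i+1)-st largest singular value of M, that is, the square
   root of the (i+1)-st largest of the n eigenvalues, counted with
   multiplicity, of the Hermitian matrix M^H M; the relevant range is
   i < min(m, n).  The eigenvalues are nonnegative reals in R[i], and their
   real parts recover them as elements of R. *)
Definition sv (R : realType) (m n : nat) (M : 'M[R[i]]_(m, n)) (i : nat) : R :=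
  let ev := spectral_diag (M ^t* *m M) in
  nth 0 (sort >=%R [seq Num.sqrt (complex.Re (ev 0 j)) | j <- enum 'I_n]) i.

(* exp (- 2 pi i / r) *)
Definition dft_root (R : realType) (r : nat) : R[i] :=
  let theta := 2 * pi / r%:R in (cos theta -i* sin theta)%C.

Definition tdft (R : realType) (m n r : nat) (A : 'T[R]_(m, n, r)) :
    'T[R[i]]_(m, n, r) :=
  [ffun k : 'I_r => \sum_(j < r)
    dft_root R r ^+ (k * j) *: map_mx (real_complex R) (A j)].

Definition tensor_sv (R : realType) (m n r : nat) (A : 'T[R]_(m, n, r))
    (i : nat) : R :=
  r%:R^-1 * \sum_(k < r) sv (tdft A k) i.

Definition tensor_sv_max (R : realType) (m n r : nat) (A : 'T[R]_(m, n, r)) : R :=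
  tensor_sv A 0.

Definition tensor_frob (R : realType) (m n r : nat) (A : 'T[R]_(m, n, r)) : R :=
  Num.sqrt (\sum_(i < m) \sum_(j < n) \sum_(k < r) A k i j ^+ 2).

(* The remainder of this file checks that [tensor_sv] reads off the diagonal of
   the first frontal slice of S in a T-SVD A = U * S * V^T, and that the values
   it returns are nonnegative and nonincreasing. *)

Definition tprod (R : realType) (m p n r : nat)
    (A : 'T[R]_(m, p, r)) (B : 'T[R]_(p, n, r)) : 'T[R]_(m, n, r) :=
  [ffun k : 'I_r =>
    \sum_(i < r) \sum_(j < r | ((i + j) %% r == k)%N) A i *m B j].

Definition ord_neg (r : nat) (k : 'I_r) : 'I_r :=
  Ordinal (ltn_pmod (r - k) (leq_ltn_trans (leq0n k) (ltn_ord k))).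

Definition ttr (R : realType) (m n r : nat) (A : 'T[R]_(m, n, r)) :
    'T[R]_(n, m, r) :=
  [ffun k => (A (ord_neg k))^T].

Definition tid (R : realType) (n r : nat) : 'T[R]_(n, n, r) :=
  [ffun k : 'I_r => if k == 0%N :> nat then 1%:M else 0].

Definition torthogonal (R : realType) (n r : nat) (Q : 'T[R]_(n, n, r)) : Prop :=
  tprod (ttr Q) Q = tid R n r /\ tprod Q (ttr Q) = tid R n r.

Record is_tsvd (R : realType) (m n r : nat) (A : 'T[R]_(m, n, r))
    (U : 'T[R]_(m, m, r)) (S : 'T[R]_(m, n, r)) (V : 'T[R]_(n, n, r)) : Prop :=
  { tsvd_eq : A = tprod (tprod U S) (ttr V);
    tsvd_orthl : torthogonal U;
    tsvd_orthr : torthogonal V;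
    tsvd_diag : forall (k : 'I_r) (i : 'I_m) (j : 'I_n),
      i != j :> nat -> S k i j = 0;
    tsvd_sv : forall (k : 'I_r) (i : 'I_m) (j : 'I_n),
      i = j :> nat -> tdft S k i j = (sv (tdft A k) i)%:C }.

Lemma dft_rootX (R : realType) (r l : nat) :
  dft_root R r ^+ l =
  (cos (2 * pi / r%:R * l%:R) -i* sin (2 * pi / r%:R * l%:R))%C.
Proof.
rewrite /dft_root; set t := 2 * pi / r%:R.
elim: l => [|l IH]; first by rewrite expr0 mulr0 cos0 sin0 oppr0.
rewrite exprSr IH -natr1 mulrDr mulr1 cosD sinD.
by congr Complex => /=; ring.
Qed.

Lemma dft_root_neq1 (R : realType) (r l : nat) :
  (0 < l < r)%N -> dft_root R r ^+ l != 1.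
Proof.
move=> /andP[l0 lr]; rewrite dft_rootX; apply/eqP => -[+ _].
have r0 : 0 < r%:R :> R by rewrite ltr0n (leq_trans _ lr).
set x : R := pi / r%:R * l%:R.
have -> : 2 * pi / r%:R * l%:R = x *+ 2 :> R by rewrite /x mulr2n; ring.
have x0 : 0 < x by rewrite /x mulr_gt0 ?ltr0n// divr_gt0// pi_gt0.
have xp : x < pi.
  by rewrite /x mulrAC ltr_pdivrMr// ltr_pM2l ?pi_gt0// ltr_nat.
have sx : 0 < sin x by apply: sin_gt0_pi; rewrite x0 xp.
rewrite mulr2n cosD -!expr2 => cx; have := cos2Dsin2 x => e.
have : 0 < sin x ^+ 2 by rewrite exprn_gt0.
by move: cx e => /=; lra.
Qed.

Lemma dft_root_unity (R : realType) (r : nat) : (0 < r)%N -> dft_root R r ^+ r = 1.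
Proof.
move=> r0; rewrite dft_rootX mulfVK ?pnatr_eq0 -?lt0n//.
by rewrite mulrC mulr_natr cos2pi sin2pi oppr0.
Qed.

Lemma sum_dft_root (R : realType) (r l : nat) : (0 < l < r)%N ->
  \sum_(k < r) dft_root R r ^+ (k * l) = 0.
Proof.
move=> lr; have r0 : (0 < r)%N by case/andP: lr => _; case: r.
apply: (@mulfI _ (dft_root R r ^+ l - 1)); first by rewrite subr_eq0 dft_root_neq1.
rewrite mulr0; under eq_bigr do rewrite mulnC exprM.
by rewrite -subrX1 -exprM mulnC exprM dft_root_unity// expr1n subrr.
Qed.

Lemma tsvd_tensor_sv (R : realType) (m n r : nat) (A : 'T[R]_(m, n, r))
    (U : 'T[R]_(m, m, r)) (S : 'T[R]_(m, n, r)) (V : 'T[R]_(n, n, r)) :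
  is_tsvd A U S V ->
  forall (k : 'I_r) (i : 'I_m) (j : 'I_n), k = 0%N :> nat -> i = j :> nat ->
  S k i j = tensor_sv A i.
Proof.
move=> svdA k0 i j k00 ij.
have r0 : (0 < r)%N by rewrite (leq_ltn_trans _ (ltn_ord k0)).
have rn0 : r%:R != 0 :> R by rewrite pnatr_eq0 -lt0n.
have H : \sum_(k < r) tdft S k i j = (r%:R * S k0 i j)%:C.
  under eq_bigr do rewrite ffunE summxE.
  rewrite exchange_big (bigD1 k0)//= [X in _ + X]big1 ?addr0.
    under eq_bigr => k _ do rewrite !mxE k00 muln0 expr0 mul1r.
    by rewrite sumr_const card_ord mulr_natl rmorphMn.
  move=> l lk; under eq_bigr do rewrite !mxE.
  rewrite -mulr_suml sum_dft_root ?mul0r// ltn_ord andbT lt0n.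
  by apply: contra lk => /eqP l0; apply/eqP/val_inj; rewrite /= l0.
rewrite /tensor_sv; apply: (mulfI rn0); rewrite mulVKf//.
apply: (@complexI R); rewrite -H rmorph_sum /=.
by apply: eq_bigr => k _; rewrite (tsvd_sv svdA).
Qed.

Lemma sv_ge0 (R : realType) (m n : nat) (M : 'M[R[i]]_(m, n)) (i : nat) :
  0 <= sv M i.
Proof.
rewrite /sv; set s := sort _ _; have [is_|?] := ltnP i (size s); last by rewrite nth_default.
have : s`_i \in s by rewrite mem_nth.
by rewrite mem_sort => /mapP[j _ ->]; rewrite sqrtr_ge0.
Qed.

Lemma sv_nonincreasing (R : realType) (m n : nat) (M : 'M[R[i]]_(m, n)) (i j : nat) :
  (i <= j)%N -> sv M j <= sv M i.
Proof.
move=> ij; have [js|js] := ltnP j n; last first.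
  rewrite {1}/sv nth_default ?sv_ge0// size_sort size_map size_enum_ord//.
rewrite /sv; set s := sort _ _.
have ss : sorted >=%R s by apply: sort_sorted => x y; apply: ge_total.
have ssz : size s = n by rewrite size_sort size_map size_enum_ord.
apply: (sorted_leq_nth _ _ 0 ss) => //.
- by move=> x y z yx /(le_trans)/(_ yx).
- by move=> x; apply: lexx.
- by rewrite inE ssz (leq_ltn_trans ij).
- by rewrite inE ssz.
Qed.

Lemma tensor_sv_ge0 (R : realType) (m n r : nat) (A : 'T[R]_(m, n, r)) (i : nat) :
  0 <= tensor_sv A i.
Proof. by rewrite mulr_ge0 ?invr_ge0 ?ler0n// sumr_ge0// => k _; apply: sv_ge0. Qed.

Lemma tensor_sv_nonincreasing (R : realType) (m n r : nat) (A : 'T[R]_(m, n, r))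
    (i j : nat) :
  (i <= j)%N -> tensor_sv A j <= tensor_sv A i.
Proof.
move=> ij; rewrite ler_wpM2l ?invr_ge0 ?ler0n// ler_sum// => k _.
exact: sv_nonincreasing.
Qed.

(* Main.v *)
Require Import Defs.
From HB Require Import structures.
From mathcomp Require Import all_boot all_order all_algebra spectral complex.
From mathcomp Require Import reals trigo.
From mathcomp Require Import perm ring lra.
Set Implicit Arguments.
Unset Strict Implicit.
Unset Printing Implicit Defensive.
Import Order.TTheory GRing.Theory Num.Theory.
Local Open Scope ring_scope.
Local Open Scope complex_scope.
Local Open Scope sesquilinear_scope.

(** Both inequalities hold slice by slice in the Fourier domain, and averaging
    over the slices keeps them.  For the complex matrices M and N that are the
    k-th transformed slices of the two tensors, the second one is Weyl's bound
    [weyl], |sigma_j(M) - sigma_j(N)| <= sigma_1(M - N), and averaging it over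
    k is the triangle inequality.  The first one is Mirsky's bound [mirsky],
    sum_i (sigma_i(M) - sigma_i(N))^2 <= ||M - N||_F^2; the square of an average
    is at most the average of the squares ([sqr_sum_le]), and by Parseval
    ([frobsq_tdft]) the average of the squared Frobenius norms of the transformed
    slices is the squared Frobenius norm of the tensor.

    Mirsky's bound comes from expanding ||M - N||_F^2: since ||M||_F^2 is the
    sum of the sigma_i(M)^2, it says that Re tr(M^* N) is at most
    sum_i sigma_i(M) sigma_i(N) (von Neumann, [redot_le_sv]).  With
    M = U1 D1 V1 and N = U2 D2 V2 ([thin_svd]), tr(M^* N) is the sum of
    sigma_i(M) sigma_j(N) X_ij Y_ji, where X = U1^* U2 and Y = V2 V1^*.  These
    are products of partial isometries, so Bessel's inequality makes
    (|X_ij|^2 + |Y_ji|^2) / 2 doubly substochastic, and a doubly substochastic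
    weight pairs two nonnegative nonincreasing sequences to at most their
    diagonal pairing ([substochastic_sum_le], two summations by parts).

    Weyl's bound comes from a nonzero vector x that is orthogonal to the right
    singular vectors of N before the j-th and to those of M after the j-th:
    these are n - 1 conditions on n unknowns.  Then
    sigma_j(M) |x| <= |M x| <= |N x| + |(M - N) x|
                   <= (sigma_j(N) + sigma_1(M - N)) |x|. *)

(** * Summation by parts *)

Lemma sum_ord_ltS (V : nmodType) (n k : nat) (kn : (k < n)%N) (F : 'I_n -> V) :
  \sum_(i < n | (i < k.+1)%N) F i = \sum_(i < n | (i < k)%N) F i + F (Ordinal kn).
Proof.
rewrite (bigD1 (Ordinal kn)) ?ltnS//= addrC; congr (_ + _).
apply: eq_bigl => i; rewrite -val_eqE /= ltnS; by case: ltngtP.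
Qed.

(** By induction on k, the sum of the t_i x_i over i < k is at least t_k times
    the k-th partial sum of x, which is nonnegative. *)
Lemma abel_sum_ge0 (R : realDomainType) (n : nat) (t : nat -> R) (x : 'I_n -> R) :
    (forall i, 0 <= t i) -> {homo t : i j / (i <= j)%N >-> j <= i} ->
    (forall k, 0 <= \sum_(i < n | (i < k)%N) x i) ->
  0 <= \sum_(i < n) t i * x i.
Proof.
move=> t0 tdec x0.
have H k : (k <= n)%N -> t k * (\sum_(i < n | (i < k)%N) x i)
    <= \sum_(i < n | (i < k)%N) t i * x i.
  elim: k => [|k IH] kn; first by rewrite !big_pred0 ?mulr0.
  rewrite (le_trans (ler_wpM2r (x0 k.+1) (tdec _ _ (leqnSn k))))//.
  by rewrite !(sum_ord_ltS kn) mulrDr lerD2r IH// ltnW.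
have := le_trans (mulr_ge0 (t0 n) (x0 n)) (H n (leqnn n)).
by congr (_ <= _); apply: eq_bigl => i; rewrite ltn_ord.
Qed.

Lemma abel_sum_le (R : realDomainType) (n : nat) (t : nat -> R) (x y : 'I_n -> R) :
    (forall i, 0 <= t i) -> {homo t : i j / (i <= j)%N >-> j <= i} ->
    (forall k, \sum_(i < n | (i < k)%N) x i <= \sum_(i < n | (i < k)%N) y i) ->
  \sum_(i < n) t i * x i <= \sum_(i < n) t i * y i.
Proof.
move=> t0 tdec xy; rewrite -subr_ge0 -sumrB.
under eq_bigr do rewrite -mulrBr.
by apply: abel_sum_ge0 => // k; rewrite sumrB subr_ge0.
Qed.

(** Summing by parts in j and then in i replaces t and s by the indicators of
    two initial segments [0, k) and [0, l), for which the claim is that the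
    block of d with rows i < l and columns j < k has total mass at most
    min(k, l): bound it by rows or by columns, whichever are fewer. *)
Lemma substochastic_sum_le (R : realDomainType) (n : nat) (s t : nat -> R)
    (d : 'I_n -> 'I_n -> R) :
    (forall i, 0 <= s i) -> {homo s : i j / (i <= j)%N >-> j <= i} ->
    (forall i, 0 <= t i) -> {homo t : i j / (i <= j)%N >-> j <= i} ->
    (forall i j, 0 <= d i j) ->
    (forall i, \sum_j d i j <= 1) -> (forall j, \sum_i d i j <= 1) ->
  \sum_(i < n) \sum_(j < n) s i * t j * d i j <= \sum_(i < n) s i * t i.
Proof.
move=> s0 sdec t0 tdec d0 drow dcol.
under eq_bigr => i _ do under eq_bigr => j _ do rewrite mulrAC mulrC.
rewrite exchange_big; under eq_bigr => j _ do rewrite -mulr_sumr.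
under [leRHS]eq_bigr => i _ do rewrite mulrC.
apply: abel_sum_le => // k; rewrite exchange_big.
under eq_bigr => i _ do rewrite -mulr_sumr.
have -> : \sum_(i < n | (i < k)%N) s i = \sum_(i < n) s i * (i < k)%:R.
  by rewrite big_mkcond; apply: eq_bigr => i _; case: ifP; rewrite ?mulr1 ?mulr0.
apply: abel_sum_le => // l.
(* k <= l: the first k columns carry at most k; otherwise, count rows. *)
have [kl|/ltnW lk] := leqP k l.
  rewrite exchange_big /=.
  have -> : \sum_(i < n | (i < l)%N) (i < k)%:R = \sum_(i < n | (i < k)%N) 1 :> R.
    rewrite (bigID (fun i : 'I_n => (i < k)%N)) /= [X in _ + X]big1 ?addr0.
      apply: eq_big => [i|i /andP[_ ->]//].
      by case: (ltnP i k) => [/leq_trans->//|]; rewrite andbF.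
    by move=> i /andP[_ /negPf->].
  apply: ler_sum => j _; apply: le_trans (dcol j).
  by rewrite [leRHS](bigID (fun i : 'I_n => (i < l)%N))/= lerDl sumr_ge0.
apply: ler_sum => i il; rewrite (leq_trans il lk); apply: le_trans (drow i).
by rewrite [leRHS](bigID (fun i : 'I_n => (i < k)%N))/= lerDl sumr_ge0.
Qed.

(** * Frobenius norm and partial isometries *)

Section SquaredNorm.
Variable R : realType.
Local Notation C := R[i].

Definition normsq (z : C) : R := complex.Re z ^+ 2 + complex.Im z ^+ 2.

Definition frobsq (m n : nat) (M : 'M[C]_(m, n)) : R := \sum_i \sum_j normsq (M i j).

(** The polar form of [frobsq]: the real part of the Frobenius inner product. *)
Definition redot (m n : nat) (M N : 'M[C]_(m, n)) : R :=
  complex.Re (\tr (M ^t* *m N)).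

Lemma normsqE (z : C) : (normsq z)%:C = Num.conj z * z.
Proof. case: z => a b; rewrite /normsq /=; apply/eqP; rewrite eq_complex /=.
by apply/andP; split; apply/eqP; ring. Qed.

Lemma normsq_ge0 z : 0 <= normsq z.
Proof. by rewrite addr_ge0 ?sqr_ge0. Qed.

Lemma normsq_conj z : normsq (Num.conj z) = normsq z.
Proof. by case: z => a b; rewrite /normsq /= sqrrN. Qed.

Lemma normsq_eq0 z : normsq z = 0 -> z = 0.
Proof.
case: z => a b /eqP; rewrite paddr_eq0 ?sqr_ge0// !sqrf_eq0 /=.
by case/andP => /eqP-> /eqP->.
Qed.

Lemma frobsq_ge0 m n (M : 'M[C]_(m, n)) : 0 <= frobsq M.
Proof. by do 2!apply: sumr_ge0 => ? _; apply: normsq_ge0. Qed.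

Lemma frobsq_eq0 m n (M : 'M[C]_(m, n)) : frobsq M = 0 -> M = 0.
Proof.
move/eqP; rewrite psumr_eq0 => [/allP H|? _]; last first.
  by apply: sumr_ge0 => ? _; apply: normsq_ge0.
apply/matrixP => i j; rewrite mxE; apply: normsq_eq0; apply/eqP.
have := H i (mem_index_enum _); rewrite implyTb psumr_eq0 => [/allP G|? _].
  by have := G j (mem_index_enum _).
exact: normsq_ge0.
Qed.

Lemma frobsqE m n (M : 'M[C]_(m, n)) : (frobsq M)%:C = \tr (M ^t* *m M).
Proof.
rewrite /frobsq rmorph_sum /mxtrace /=; under eq_bigr do rewrite rmorph_sum /=.
rewrite exchange_big; apply: eq_bigr => j _; rewrite mxE; apply: eq_bigr => i _.
by rewrite normsqE !mxE.
Qed.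

Lemma adjM m n p (A : 'M[C]_(m, n)) (B : 'M[C]_(n, p)) :
  (A *m B)^t* = B^t* *m A^t*.
Proof. by rewrite trmx_mul map_mxM. Qed.

Lemma frobsq_adj m n (M : 'M[C]_(m, n)) : frobsq (M^t*) = frobsq M.
Proof.
rewrite /frobsq exchange_big; do 2!apply: eq_bigr => ? _.
by rewrite !mxE; apply: normsq_conj.
Qed.

Lemma gram_eq0 m n (M : 'M[C]_(m, n)) : M^t* *m M = 0 -> M = 0.
Proof.
move=> M0; apply: frobsq_eq0; apply: (@complexI R).
by rewrite frobsqE M0 mxtrace0.
Qed.

Lemma Re_sum (I : Type) (s : seq I) (P : pred I) (F : I -> C) :
  complex.Re (\sum_(i <- s | P i) F i) = \sum_(i <- s | P i) complex.Re (F i).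
Proof. by apply: (big_morph _ _ _) => // -[a b] [c d]. Qed.

Lemma redotE m n (M N : 'M[C]_(m, n)) : redot M N =
  \sum_i \sum_j (complex.Re (M i j) * complex.Re (N i j)
                 + complex.Im (M i j) * complex.Im (N i j)).
Proof.
rewrite /redot Re_sum exchange_big; apply: eq_bigr => j _.
rewrite mxE Re_sum; apply: eq_bigr => i _; rewrite !mxE.
by case: (M i j) => a b; case: (N i j) => c d /=; ring.
Qed.

Lemma frobsqB m n (M N : 'M[C]_(m, n)) :
  frobsq (M - N) = frobsq M + frobsq N - redot M N *+ 2.
Proof.
rewrite redotE /frobsq -!sumrMnl -big_split -sumrB /=; apply: eq_bigr => i _.
rewrite -!sumrMnl -big_split -sumrB /=; apply: eq_bigr => j _; rewrite !mxE /normsq.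
by case: (M i j) => a b; case: (N i j) => c d /=; ring.
Qed.

(** For p, q > 0 this is |u + v|^2 <= (p + q) (|u|^2 / p + |v|^2 / q), with the
    denominators cleared; entrywise, the difference of the two sides is
    |q u - p v|^2. *)
Lemma frobsqD_le m n (M N : 'M[C]_(m, n)) (p q : R) :
  p * q * frobsq (M + N) <= (p + q) * (q * frobsq M + p * frobsq N).
Proof.
rewrite /frobsq !mulr_sumr -big_split mulr_sumr; apply: ler_sum => i _ /=.
rewrite !mulr_sumr -big_split mulr_sumr; apply: ler_sum => j _ /=.
rewrite /normsq mxE; case: (M i j) => a b; case: (N i j) => c d /=.
rewrite -subr_ge0 [leRHS](_ : _ = (q * a - p * c) ^+ 2 + (q * b - p * d) ^+ 2).
  by rewrite addr_ge0 ?sqr_ge0.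
by ring.
Qed.

(** The triangle inequality for the Frobenius norm, where the square root of x is
    the unit of length: [frobsqD_le] gives it when p and q are positive, and if
    one of them is 0 then so is the matrix that it bounds. *)
Lemma frobsq_triangle m n (M N : 'M[C]_(m, n)) (p q x : R) : 0 <= p -> 0 <= q ->
  frobsq M <= p ^+ 2 * x -> frobsq N <= q ^+ 2 * x -> frobsq (M + N) <= (p + q) ^+ 2 * x.
Proof.
rewrite le_eqVlt => /predU1P[<-|p0].
  move=> _; rewrite expr0n mul0r add0r => M0; have -> : M = 0; last by rewrite add0r.
  by apply/frobsq_eq0/le_anti; rewrite M0 frobsq_ge0.
rewrite le_eqVlt => /predU1P[<-|q0] HM.
  rewrite expr0n mul0r addr0 => N0; have -> : N = 0; last by rewrite addr0.
  by apply/frobsq_eq0/le_anti; rewrite N0 frobsq_ge0.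
move=> HN; rewrite -(ler_pM2l (mulr_gt0 p0 q0)).
apply: le_trans (frobsqD_le M N p q) _.
have -> : p * q * ((p + q) ^+ 2 * x) = (p + q) * (q * (p ^+ 2 * x) + p * (q ^+ 2 * x)).
  by ring.
by rewrite ler_pM2l ?addr_gt0// lerD// ler_pM2l.
Qed.

Definition partial_isometry (m n : nat) (W : 'M[C]_(m, n)) := W *m W^t* *m W = W.

Lemma piso_adj m n (W : 'M[C]_(m, n)) : partial_isometry W -> partial_isometry (W^t*).
Proof.
rewrite /partial_isometry => /(congr1 (fun X => X^t*)).
by rewrite !adjM trmxCK mulmxA.
Qed.

Lemma piso_unitary n (W : 'M[C]_n) : W \is unitarymx -> partial_isometry W.
Proof. by move/unitarymxP => WW; rewrite /partial_isometry WW mul1mx. Qed.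

(** Bessel's inequality for the rows of A: W W^* is the orthogonal projection P
    on the column space of W, so ||A||^2 = ||A W||^2 + ||A (1 - P)||^2. *)
Lemma frobsq_mul_piso_le k m n (A : 'M[C]_(k, m)) (W : 'M[C]_(m, n)) :
  partial_isometry W -> frobsq (A *m W) <= frobsq A.
Proof.
move=> WW; pose Q := 1%:M - W *m W^t*.
have Qadj : Q^t* = Q.
  by rewrite /Q linearB /= map_mxB trmx1 map_mx1 adjM trmxCK.
have QQ : Q *m Q = Q.
  by rewrite {2}/Q mulmxBr mulmx1 mulmxA /Q mulmxBl mul1mx WW subrr mul0mx subr0.
suff -> : frobsq A = frobsq (A *m W) + frobsq (A *m Q) by rewrite lerDl frobsq_ge0.
apply: (@complexI R); rewrite rmorphD /= -(frobsq_adj A) -(frobsq_adj (A *m W)).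
rewrite -(frobsq_adj (A *m Q)) !frobsqE !trmxCK !adjM Qadj -mxtraceD.
rewrite !mulmxA -(mulmxA A Q) QQ -mulmxDl -(mulmxA A W) -mulmxDr.
by rewrite /Q addrC subrK mulmx1.
Qed.

Lemma frobsq_delta n (i : 'I_n) : frobsq (delta_mx 0 i : 'rV[C]_n) = 1.
Proof.
rewrite /frobsq big_ord1 (bigD1 i)//= big1 => [|j ji].
  by rewrite mxE !eqxx /normsq /= expr1n expr0n !addr0.
by rewrite mxE (negPf ji) andbF /normsq /= expr0n addr0.
Qed.

(** Row i is e_i P Q, and neither factor increases the norm of e_i. *)
Lemma piso_mul_row_le m n p (P : 'M[C]_(m, n)) (Q : 'M[C]_(n, p)) i :
  partial_isometry P -> partial_isometry Q -> \sum_j normsq ((P *m Q) i j) <= 1.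
Proof.
move=> Pp Qp; rewrite -(frobsq_delta i).
apply: le_trans (frobsq_mul_piso_le (delta_mx 0 i) Pp).
apply: le_trans (frobsq_mul_piso_le _ Qp).
rewrite -mulmxA -rowE /frobsq big_ord1.
by apply: ler_sum => j _; rewrite !mxE.
Qed.

Lemma piso_mul_col_le m n p (P : 'M[C]_(m, n)) (Q : 'M[C]_(n, p)) j :
  partial_isometry P -> partial_isometry Q -> \sum_i normsq ((P *m Q) i j) <= 1.
Proof.
move=> /piso_adj Pp /piso_adj Qp; apply: le_trans (piso_mul_row_le j Qp Pp).
by apply: ler_sum => i _; rewrite -adjM !mxE -[leLHS]normsq_conj.
Qed.

End SquaredNorm.

(** * Singular value decomposition *)

Section SingularValues.
Variable R : realType.
Local Notation C := R[i].

Definition sv_row (m n : nat) (M : 'M[C]_(m, n)) : 'rV[C]_n :=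
  \row_i (sv M i)%:C.

Lemma diag_mx_adj n (a : 'I_n -> R) :
  (diag_mx (\row_i (a i)%:C))^t* = diag_mx (\row_i (a i)%:C).
Proof.
rewrite tr_diag_mx map_diag_mx; congr diag_mx; apply/rowP => i.
by rewrite !mxE; apply: conjc_real.
Qed.

Lemma mulmx_diag_entry m n p (A : 'M[C]_(m, n)) (d : 'rV[C]_n) (B : 'M[C]_(n, p)) i j :
  (A *m diag_mx d *m B) i j = \sum_k d 0 k * (A i k * B k j).
Proof.
rewrite mxE; apply: eq_bigr => k _; rewrite mul_mx_diag mxE.
by rewrite mulrAC mulrC mulrA.
Qed.

Lemma gram_normal m n (M : 'M[C]_(m, n)) : M^t* *m M \is normalmx.
Proof. by apply/normalmxP; rewrite adjM trmxCK. Qed.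

(** The eigenvalue of M^* M at the i-th eigenvector v_i is |M v_i|^2, so it is a
    nonnegative real. *)
Lemma gram_spectral m n (M : 'M[C]_(m, n)) :
  exists P : 'M[C]_n, exists a : 'I_n -> R,
  [/\ P \is unitarymx, forall i, 0 <= a i,
      forall i, spectral_diag (M^t* *m M) 0 i = (a i)%:C
    & M^t* *m M = P^t* *m diag_mx (\row_i (a i)%:C) *m P].
Proof.
set G := M^t* *m M; set P := spectralmx G.
have Pu : P \is unitarymx by apply: spectral_unitarymx.
have PP : P *m P^t* = 1%:M by apply/unitarymxP.
have GE : G = P^t* *m diag_mx (spectral_diag G) *m P.
  by rewrite -invmx_unitary//; apply/orthomx_spectralP/gram_normal.
have dE i : spectral_diag G 0 i = (frobsq (col i (M *m P^t*)))%:C.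
  have : P *m G *m P^t* = diag_mx (spectral_diag G).
    by rewrite {1}GE !mulmxA PP mul1mx -mulmxA PP mulmx1.
  move=> /matrixP/(_ i i); rewrite [RHS]mxE eqxx mulr1n => <-.
  rewrite frobsqE /mxtrace big_ord1 /G -{1}(trmxCK P) mulmxA -mulmxA -adjM.
  by rewrite !mxE; apply: eq_bigr => k _; rewrite !mxE.
exists P, (fun i => frobsq (col i (M *m P^t*))); split; [exact: Pu | | exact: dE |].
  by move=> i; apply: frobsq_ge0.
have <- : spectral_diag G = \row_i (frobsq (col i (M *m P^t*)))%:C.
  by apply/rowP => i; rewrite dE mxE.
exact: GE.
Qed.

(** The rows of V are the eigenvectors of M^* M permuted by the sort that defines
    the singular values, so that the i-th row belongs to the i-th largest. *)
Lemma sv_gram m n (M : 'M[C]_(m, n)) : exists2 V : 'M[C]_n, V \is unitarymx &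
  M^t* *m M = V^t* *m (diag_mx (sv_row M) *m diag_mx (sv_row M)) *m V.
Proof.
have [P [a [Pu a0 da GE]]] := gram_spectral M.
pose f i := Num.sqrt (a i).
have svE i : sv M i = nth 0 (sort >=%R [seq f j | j <- enum 'I_n]) i.
  by rewrite /sv; congr (nth 0 (sort _ _) i); apply: eq_map => j; rewrite da.
have /tuple_permP[p pE] : perm_eq (sort >=%R [seq f j | j <- enum 'I_n])
    [tuple of [seq f j | j <- ord_tuple n]].
  by rewrite perm_sort.
have svp (i : 'I_n) : sv M i = f (p i).
  rewrite svE pE (nth_map i) ?size_enum_ord// nth_ord_enum.
  by rewrite tnth_map tnth_ord_tuple.
exists (row_perm p P).
  rewrite row_permE; apply: mul_unitarymx Pu.
  by apply/unitarymxP; rewrite tr_perm_mx map_perm_mx -perm_mxM mulgV perm_mx1.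
rewrite mulmx_diag GE; apply/matrixP => i j; rewrite !mulmx_diag_entry.
rewrite (reindex_inj (@perm_inj _ p)); apply: eq_bigr => k _.
by rewrite !mxE -rmorphM svp -expr2 /f sqr_sqrtr.
Qed.

Lemma sv_eigenbasis m n (M : 'M[C]_(m, n)) : exists2 V : 'M[C]_n, V \is unitarymx &
  forall x : 'cV[C]_n, frobsq (M *m x) = \sum_(i < n) sv M i ^+ 2 * normsq ((V *m x) i 0).
Proof.
have [V Vu GE] := sv_gram M; exists V => // x.
apply: (@complexI R); rewrite frobsqE adjM mulmxA -(mulmxA _ _ M) GE mulmx_diag.
rewrite !mulmxA -adjM -(mulmxA _ V) /mxtrace big_ord1 mulmx_diag_entry rmorph_sum.
apply: eq_bigr => i _ /=.
by rewrite rmorphM /= normsqE mxE [X in X * X]mxE -rmorphM -expr2 [X in _ * (X * _)]mxE mxE.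
Qed.

(** With K = M V^*, whose columns are orthogonal of norms sv M i, put U = K D^-1,
    where D^-1 inverts the nonzero entries of D and keeps the zeros.  The zero
    singular values give zero columns of U, so U is only a partial isometry; this
    avoids completing it to a unitary matrix, and Bessel's inequality asks for no
    more. *)
Lemma thin_svd m n (M : 'M[C]_(m, n)) : exists U : 'M[C]_(m, n), exists V : 'M[C]_n,
  [/\ partial_isometry U, V \is unitarymx & M = U *m diag_mx (sv_row M) *m V].
Proof.
have [V Vu GE] := sv_gram M; set D := diag_mx _ in GE.
pose D' : 'M[C]_n := diag_mx (\row_i ((sv M i)^-1)%:C).
have D'adj : D'^t* = D' by apply: diag_mx_adj.
have D4 : D' *m D' *m (D *m D) *m D' = D'.
  rewrite !mulmx_diag; congr diag_mx; apply/rowP => i; rewrite !mxE -!rmorphM.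
  congr (_%:C); have [->|?] := eqVneq (sv M i) 0; first by rewrite invr0 !mulr0.
  by field.
have DD'D : D *m D' *m D = D.
  rewrite !mulmx_diag; congr diag_mx; apply/rowP => i; rewrite !mxE -!rmorphM.
  by congr (_%:C); have [->|?] := eqVneq (sv M i) 0; rewrite ?mulr0// mulfV// mul1r.
have VV : V *m V^t* = 1%:M by apply/unitarymxP.
have VV' : V^t* *m V = 1%:M by apply/mulmx1C.
pose K := M *m V^t*.
have KK : K^t* *m K = D *m D.
  rewrite /K adjM trmxCK mulmxA -(mulmxA V) GE !mulmxA VV mul1mx -!mulmxA VV.
  by rewrite mulmx1.
exists (K *m D'), V; split => //.
  rewrite /partial_isometry adjM D'adj.
  transitivity (K *m (D' *m D' *m (K^t* *m K) *m D')); first by rewrite !mulmxA.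
  by rewrite KK D4.
(* The columns of K at the zero singular values have norm 0. *)
have : K *m (1%:M - D' *m D) = 0.
  apply: gram_eq0; rewrite adjM mulmxA -(mulmxA _ (K^t*)) KK -mulmxA -(mulmxA D).
  by rewrite [D *m (1%:M - _)]mulmxBr mulmx1 (mulmxA D D' D) DD'D subrr !mulmx0.
rewrite mulmxBr mulmx1 => /eqP; rewrite subr_eq0 => /eqP KE.
by rewrite -(mulmxA K) -KE /K -mulmxA VV' mulmx1.
Qed.
End SingularValues.

(** * Perturbation of the singular values of a matrix *)

Section Perturbation.
Variable R : realType.
Local Notation C := R[i].

Lemma frobsq_unitary n (V : 'M[C]_n) (x : 'cV[C]_n) :
  V \is unitarymx -> frobsq (V *m x) = frobsq x.
Proof.
move=> /unitarymxP/mulmx1C VV; apply: (@complexI R).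
by rewrite !frobsqE adjM mulmxA -(mulmxA _ _ V) VV mulmx1.
Qed.

Lemma frobsq_sv m n (M : 'M[C]_(m, n)) : frobsq M = \sum_(i < n) sv M i ^+ 2.
Proof.
have [V /unitarymxP VV GE] := sv_gram M.
apply: (@complexI R); rewrite frobsqE GE mulmx_diag mxtrace_mulC mulmxA VV mul1mx.
rewrite mxtrace_diag rmorph_sum; apply: eq_bigr => i _.
by rewrite !mxE -rmorphM -expr2.
Qed.

(** Von Neumann's trace inequality: in the singular bases the left-hand side is
    the sum of the real parts of sv M i * sv N j * X i j * Y j i, and the
    arithmetic-geometric mean bounds the last two factors by the doubly
    substochastic weight d. *)
Lemma redot_le_sv m n (M N : 'M[C]_(m, n)) :
  redot M N <= \sum_(i < n) sv M i * sv N i.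
Proof.
have [U1 [V1 [U1p V1u ME]]] := thin_svd M.
have [U2 [V2 [U2p V2u NE]]] := thin_svd N.
pose X := U1^t* *m U2; pose Y := V2 *m V1^t*.
have V1p := piso_adj (piso_unitary V1u); have V2p := piso_unitary V2u.
pose d i j := (normsq (X i j) + normsq (Y j i)) / 2.
have trE : \tr (M^t* *m N) =
    \sum_(i < n) \sum_(j < n) (sv M i * sv N j)%:C * (X i j * Y j i).
  rewrite {1}ME {1}NE !adjM diag_mx_adj.
  transitivity (\tr (V1^t* *m (diag_mx (sv_row M) *m X *m diag_mx (sv_row N) *m V2))).
    by rewrite /X !mulmxA.
  rewrite mxtrace_mulC -(mulmxA _ V2) -/Y /mxtrace; apply: eq_bigr => i _.
  rewrite mulmx_diag_entry; apply: eq_bigr => j _.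
  rewrite [sv_row N _ _]mxE mul_diag_mx [X in _ * (X * _)]mxE [sv_row M _ _]mxE.
  by rewrite rmorphM -!mulrA mulrCA.
apply: (@le_trans _ _ (\sum_(i < n) \sum_(j < n) sv M i * sv N j * d i j)).
  rewrite /redot trE Re_sum; apply: ler_sum => i _.
  rewrite Re_sum; apply: ler_sum => j _.
  have -> (a : R) (z : C) : complex.Re (a%:C * z) = a * complex.Re z.
    by case: z => b c /=; rewrite mul0r subr0.
  apply: ler_wpM2l; first by rewrite mulr_ge0 ?sv_ge0.
  rewrite /d /normsq; case: (X i j) => a b; case: (Y j i) => c e /=.
  have := sqr_ge0 (a - c); have := sqr_ge0 (b + e); nra.
apply: substochastic_sum_le => //; try by move=> *; apply: sv_ge0.
- by move=> i j; apply: sv_nonincreasing.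
- by move=> i j; apply: sv_nonincreasing.
- by move=> i j; apply: divr_ge0; [apply: addr_ge0; apply: normsq_ge0 | apply: ler0n].
- move=> i; rewrite -mulr_suml big_split ler_pdivrMr//= mul1r.
  by apply: lerD; [apply: piso_mul_row_le (piso_adj U1p) U2p | apply: piso_mul_col_le].
- move=> j; rewrite -mulr_suml big_split ler_pdivrMr//= mul1r.
  by apply: lerD; [apply: piso_mul_col_le (piso_adj U1p) U2p | apply: piso_mul_row_le].
Qed.

(** The sum runs over all n eigenvalues of M^* M, not only over the first
    min(m, n); the extra terms are squares, so this form is the stronger one. *)
Lemma mirsky m n (M N : 'M[C]_(m, n)) :
  \sum_(i < n) (sv M i - sv N i) ^+ 2 <= frobsq (M - N).
Proof.
rewrite frobsqB !frobsq_sv; under eq_bigr do rewrite sqrrB addrAC.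
by rewrite sumrB big_split /= sumrMnl lerD2l lerN2 lerMn2r redot_le_sv orbT.
Qed.

Lemma svN m n (M : 'M[C]_(m, n)) i : sv (- M) i = sv M i.
Proof.
rewrite /sv; suff -> : (- M)^t* *m - M = M^t* *m M by [].
have -> : (- M)^t* = - M^t* by apply/matrixP => a b; rewrite !mxE rmorphN.
by rewrite mulNmx mulmxN opprK.
Qed.

Lemma frobsq_mulmx_le m n (M : 'M[C]_(m, n)) (x : 'cV[C]_n) :
  frobsq (M *m x) <= sv M 0 ^+ 2 * frobsq x.
Proof.
have [V Vu E] := sv_eigenbasis M.
have Vx := frobsq_unitary x Vu.
rewrite E -Vx /frobsq mulr_sumr; apply: ler_sum => i _; rewrite big_ord1.
by rewrite ler_wpM2r ?normsq_ge0// lerXn2r ?nnegrE ?sv_ge0// sv_nonincreasing.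
Qed.

(** The vector x is orthogonal to all but the first j + 1 right singular vectors
    of M, so |M x| >= sv M j |x|, and to the first j of N, so
    |N x| <= sv N j |x|. *)
Lemma weyl_sub m n (M N : 'M[C]_(m, n)) j : (j < n)%N ->
  sv M j <= sv N j + sv (M - N) 0.
Proof.
move=> jn; have [V1 V1u E1] := sv_eigenbasis M; have [V2 V2u E2] := sv_eigenbasis N.
(* The n - 1 orthogonality conditions fill all columns of A but the j-th, which
   is 0, so that A has a nonzero left kernel. *)
pose A := \matrix_(a < n, i < n)
  (if (i < j)%N then V2 i a else if (j < i)%N then V1 i a else 0).
have /det0P[v v0 vA] : \det A == 0.
  rewrite (expand_det_col _ (Ordinal jn)) big1// => i _.
  by rewrite mxE /= ltnn mul0r.
pose x := v^T.
have x0 : 0 < frobsq x.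
  rewrite lt_neqAle frobsq_ge0 andbT eq_sym; apply: contra v0 => /eqP/frobsq_eq0 xE.
  by rewrite -(trmxK v) -/x xE trmx0.
have V2x (i : 'I_n) : (i < j)%N -> (V2 *m x) i 0 = 0.
  move=> ij; have /rowP/(_ i) := vA; rewrite !mxE => vAi; rewrite -[RHS]vAi.
  by apply: eq_bigr => a _; rewrite !mxE ij mulrC.
have V1x (i : 'I_n) : (j < i)%N -> (V1 *m x) i 0 = 0.
  move=> ij; have /rowP/(_ i) := vA; rewrite !mxE => vAi; rewrite -[RHS]vAi.
  by apply: eq_bigr => a _; rewrite !mxE ij ltnNge (ltnW ij) mulrC.
have HM : sv M j ^+ 2 * frobsq x <= frobsq (M *m x).
  rewrite E1 -(frobsq_unitary x V1u) /frobsq mulr_sumr.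
  apply: ler_sum => i _; rewrite big_ord1.
  have [ij|ji] := leqP i j; last by rewrite V1x// /normsq /= !expr0n addr0 !mulr0.
  by rewrite ler_wpM2r ?normsq_ge0// lerXn2r ?nnegrE ?sv_ge0// sv_nonincreasing.
have HN : frobsq (N *m x) <= sv N j ^+ 2 * frobsq x.
  rewrite E2 -(frobsq_unitary x V2u) /frobsq mulr_sumr.
  apply: ler_sum => i _; rewrite big_ord1.
  have [ij|ji] := ltnP i j; first by rewrite V2x// /normsq /= !expr0n addr0 !mulr0.
  by rewrite ler_wpM2r ?normsq_ge0// lerXn2r ?nnegrE ?sv_ge0// sv_nonincreasing.
have := frobsq_triangle (sv_ge0 N j) (sv_ge0 (M - N) 0) HN (frobsq_mulmx_le (M - N) x).
rewrite -mulmxDl addrC subrK => /(le_trans HM).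
by rewrite ler_pM2r// ler_pXn2r ?nnegrE ?addr_ge0 ?sv_ge0.
Qed.

Lemma weyl m n (M N : 'M[C]_(m, n)) j : (j < n)%N ->
  `|sv M j - sv N j| <= sv (M - N) 0.
Proof.
move=> jn; rewrite ler_distl lerBlDr addrC weyl_sub// andbT.
by rewrite -(svN (M - N)) opprB addrC weyl_sub.
Qed.
End Perturbation.

(** * Parseval's identity and tensors *)

Section Fourier.
Variable R : realType.
Local Notation C := R[i].

Lemma dft_root_conj (r l : nat) : Num.conj (dft_root R r ^+ l) * dft_root R r ^+ l = 1.
Proof.
rewrite dft_rootX -normsqE /normsq /= sqrrN; congr (_%:C); exact: cos2Dsin2.
Qed.

Lemma dft_root_conjB (r l p : nat) : (l <= p)%N ->
  Num.conj (dft_root R r ^+ l) * dft_root R r ^+ p = dft_root R r ^+ (p - l).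
Proof. by move=> lp; rewrite -{1}(subnKC lp) exprD mulrA dft_root_conj mul1r. Qed.

(** For l <= p the k-th summand is the power k (p - l) of the root of unity, and
    these powers sum to 0 unless p = l; the other case is its conjugate. *)
Lemma dft_orthogonal (r : nat) (l p : 'I_r) :
  \sum_(k < r) Num.conj (dft_root R r ^+ (k * l)) * dft_root R r ^+ (k * p)
  = (r%:R *+ (l == p))%:C.
Proof.
wlog lp : l p / (l <= p)%N => [H|].
  have [/H//|/ltnW pl] := leqP l p; have /esym E := H p l pl.
  have realE (x : R) : x%:C = Num.conj x%:C :> C by exact/esym/conjc_real.
  rewrite eq_sym realE E rmorph_sum.
  by apply: eq_bigr => k _; rewrite /= rmorphM /= conjCK mulrC.
under eq_bigr do rewrite dft_root_conjB ?leq_mul2l ?lp ?orbT// -mulnBr.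
have [<-|neq] := eqVneq l p.
  under eq_bigr do rewrite subnn muln0 expr0.
  by rewrite sumr_const card_ord mulr1n rmorph_nat.
rewrite sum_dft_root// subn_gt0 ltn_neqAle neq lp /=.
by rewrite (leq_ltn_trans (leq_subr _ _)).
Qed.

Lemma conjcMr (z : C) (a : R) : Num.conj (z * a%:C) = Num.conj z * a%:C.
Proof.
by case: z => b c; apply/eqP; rewrite eq_complex /=; apply/andP; split; apply/eqP; ring.
Qed.

Lemma parseval (r : nat) (a : 'I_r -> R) :
  \sum_(k < r) normsq (\sum_(l < r) dft_root R r ^+ (k * l) * (a l)%:C)
  = r%:R * \sum_(l < r) a l ^+ 2.
Proof.
apply: (@complexI R); rewrite rmorph_sum /=.
transitivity (\sum_(k < r) \sum_(l < r) \sum_(p < r) (a l * a p)%:C *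
    (Num.conj (dft_root R r ^+ (k * l)) * dft_root R r ^+ (k * p))).
  apply: eq_bigr => k _; rewrite normsqE rmorph_sum /= mulr_suml; apply: eq_bigr => l _.
  rewrite mulr_sumr; apply: eq_bigr => p _.
  rewrite conjcMr (rmorphM (real_complex R)) mulrACA mulrC; congr (_ * _).
have orthE (l p : 'I_r) : \sum_(k < r) (a l * a p)%:C *
    (Num.conj (dft_root R r ^+ (k * l)) * dft_root R r ^+ (k * p)) =
    (a l * a p * (r%:R *+ (l == p)))%:C.
  by rewrite (rmorphM (real_complex R) (_ * _)) /= -dft_orthogonal mulr_sumr.
rewrite exchange_big mulr_sumr rmorph_sum; apply: eq_bigr => l _ /=.
rewrite exchange_big (bigD1 l)//= [X in _ + X]big1 ?addr0 => [|p pl].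
  by rewrite orthE eqxx mulr1n mulrC -expr2.
by rewrite orthE eq_sym (negPf pl) mulr0n mulr0.
Qed.

Lemma tdftB (m n r : nat) (A B : 'T[R]_(m, n, r)) k :
  tdft (A - B) k = tdft A k - tdft B k.
Proof.
rewrite !ffunE -sumrB; apply: eq_bigr => l _.
by rewrite !ffunE map_mxB scalerBr.
Qed.

Lemma frobsq_tdft (m n r : nat) (A : 'T[R]_(m, n, r)) :
  \sum_(k < r) frobsq (tdft A k) =
  r%:R * \sum_(i < m) \sum_(j < n) \sum_(k < r) A k i j ^+ 2.
Proof.
rewrite exchange_big mulr_sumr; apply: eq_bigr => i _ /=.
rewrite exchange_big mulr_sumr; apply: eq_bigr => j _ /=.
rewrite -parseval; apply: eq_bigr => k _; congr normsq.
by rewrite ffunE summxE; apply: eq_bigr => l _; rewrite !mxE.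
Qed.

Lemma tensor_svB (m n r : nat) (A B : 'T[R]_(m, n, r)) i :
  tensor_sv A i - tensor_sv B i =
  r%:R^-1 * \sum_(k < r) (sv (tdft A k) i - sv (tdft B k) i).
Proof. by rewrite /tensor_sv -mulrBr sumrB. Qed.

End Fourier.

(** The difference of the two sides is half the sum of the (x_k - x_l)^2. *)
Lemma sqr_sum_le (R : realFieldType) (r : nat) (x : 'I_r -> R) :
  (\sum_k x k) ^+ 2 <= r%:R * \sum_k x k ^+ 2.
Proof.
have : 0 <= \sum_k \sum_l (x k - x l) ^+ 2.
  by do 2!apply: sumr_ge0 => ? _; apply: sqr_ge0.
have -> : \sum_k \sum_l (x k - x l) ^+ 2 =
    (r%:R * \sum_k x k ^+ 2 - (\sum_k x k) ^+ 2) *+ 2.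
  have inner k : \sum_l (x k - x l) ^+ 2 =
      r%:R * x k ^+ 2 + \sum_l x l ^+ 2 - x k * (\sum_l x l) *+ 2.
    under eq_bigr do rewrite sqrrB addrAC.
    by rewrite sumrB big_split /= sumr_const card_ord sumrMnl -mulr_sumr mulr_natl.
  under eq_bigr do rewrite inner.
  rewrite sumrB big_split /= sumr_const card_ord sumrMnl -mulr_suml -mulr_sumr.
  by rewrite -[(\sum_l x l ^+ 2) *+ r]mulr_natl; ring.
by rewrite pmulrn_lge0 // subr_ge0.
Qed.

Theorem theorem4p1 (R : realType) (m n r : nat)
    (hm : (0 < m)%N) (hn : (0 < n)%N) (hr : (0 < r)%N)
    (A B : 'T[R]_(m, n, r)) :
  Num.sqrt (\sum_(i < minn m n) (tensor_sv A i - tensor_sv B i) ^+ 2)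
    <= tensor_frob (B - A)
  /\ (forall j : 'I_(minn m n),
        `|tensor_sv A j - tensor_sv B j| <= tensor_sv_max (B - A)).
Proof.
have r0 : 0 < r%:R :> R by rewrite ltr0n.
split=> [|j].
  apply: ler_wsqrtr.
  (* [mirsky] bounds a sum over i < n, so extend the range from min(m, n) to n. *)
  apply: (@le_trans _ _ (\sum_(i < n) (tensor_sv B i - tensor_sv A i) ^+ 2)).
    under eq_bigr do rewrite -sqrrN opprB.
    pose F i := (tensor_sv B i - tensor_sv A i) ^+ 2.
    rewrite -(big_mkord xpredT F) -[leRHS](big_mkord xpredT F).
    rewrite [leRHS](big_cat_nat _ (geq_minr m n))//= lerDl.
    by apply: sumr_ge0 => i _; apply: sqr_ge0.
  rewrite -(ler_pM2l r0) -frobsq_tdft.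
  apply: (@le_trans _ _ (\sum_(k < r) \sum_(i < n) (sv (tdft B k) i - sv (tdft A k) i) ^+ 2)).
    rewrite exchange_big mulr_sumr; apply: ler_sum => i _ /=.
    rewrite tensor_svB exprMn mulrA expr2 mulVKf ?gt_eqF// mulrC.
    by rewrite ler_pdivrMr// mulrC sqr_sum_le.
  by apply: ler_sum => k _; rewrite tdftB mirsky.
rewrite distrC tensor_svB normrM ger0_norm ?invr_ge0 ?ler0n// ler_pM2l ?invr_gt0//.
apply: le_trans (ler_norm_sum _ _ _) _; apply: ler_sum => k _.
by rewrite tdftB weyl// (leq_trans (ltn_ord j)) ?geq_minr.
Qed.
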